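(* There is a bijective correspondence between the collection of all skeletal $Leib_\infty$-conformal algebras and the collection of all tuples of the form $(\mathfrak{g},M,\theta)$, where $\mathfrak{g}$ is a Leibniz conformal algebra, $M$ is a representation of $\mathfrak{g}$ and $\theta\in Z^3(\mathfrak{g},M)$ is a $3$-cocycle. Moreover, this correspondence further extends to a bijection between the equivalence classes of all skeletal $Leib_\infty$-conformal algebras and tuples of the form $(\mathfrak{g},M,[\theta])$, where $[\theta]\in H^3(\mathfrak{g},M)$ is a third cohomology class.
   Context: Tensor products are over $\mathbb{C}$; $\partial$ acts coefficientwise on formal power series, and maps are extended coefficientwise to power series arguments. For $\mathbb{C}[\partial]$-modules, a $\mathbb{C}$-linear map $\varphi:M_1\otimes\cdots\otimes M_n\to N[[\lambda_1,\ldots,\lambda_{n-1}]]$ is conformal sesquilinear if $\varphi_{\lambda_1,\ldots,\lambda_{n-1}}(x_1,\ldots,\partial x_i,\ldots,x_n)=-\lambda_i\varphi_{\lambda_1,\ldots,\lambda_{n-1}}(x_1,\ldots,x_n)$ for $1\le i\le n-1$ and $\varphi_{\lambda_1,\ldots,\lambda_{n-1}}(x_1,\ldots,x_{n-1},\partial x_n)=(\partial+\lambda_1+\cdots+\lambda_{n-1})\varphi_{\lambda_1,\ldots,\lambda_{n-1}}(x_1,\ldots,x_n)$. A Leibniz conformal algebra is a $\mathbb{C}[\partial]$-module $\mathfrak{g}$ with a conformal sesquilinear $\lambda$-bracket $[\cdot_\lambda\cdot]:\mathfrak{g}\otimes\mathfrak{g}\to\mathfrak{g}[[\lambda]]$ satisfying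 $[x_\lambda[y_\mu z]]=[[x_\lambda y]_{\lambda+\mu}z]+[y_\mu[x_\lambda z]]$. A representation is a $\mathbb{C}[\partial]$-module $M$ with conformal sesquilinear maps $\mathfrak{g}\otimes M\to M[[\lambda]]$, $x\otimes v\mapsto x_\lambda v$ and $M\otimes\mathfrak{g}\to M[[\lambda]]$, $v\otimes x\mapsto v_\lambda x$ such that $x_\lambda(y_\mu v)=[x_\lambda y]_{\lambda+\mu}v+y_\mu(x_\lambda v)$, $x_\lambda(v_\mu y)=(x_\lambda v)_{\lambda+\mu}y+v_\mu[x_\lambda y]$, $v_\lambda[x_\mu y]=(v_\lambda x)_{\lambda+\mu}y+x_\mu(v_\lambda y)$. Cohomology: for $n\ge1$, $C^n(\mathfrak{g},M)$ is the space of conformal sesquilinear maps $\mathfrak{g}^{\otimes n}\to M[[\lambda_1,\ldots,\lambda_{n-1}]]$, with $\delta:C^n\to C^{n+1}$, $$(\delta\varphi)_{\lambda_1,\ldots,\lambda_n}(x_1,\ldots,x_{n+1})=\sum_{i=1}^n(-1)^{i+1}{x_i}_{\lambda_i}\big(\varphi_{\lambda_1,\ldots,\widehat{\lambda_i},\ldots,\lambda_n}(x_1,\ldots,\widehat{x_i},\ldots,x_{n+1})\big)+(-1)^{n+1}\big(\varphi_{\lambda_1,\ldots,\lambda_{n-1}}(x_1,\ldots,x_n)\big)_{\lambda_1+\cdots+\lambda_n}x_{n+1}$$ $$+\sum_{1\le i<j\le n+1}(-1)^i\varphi_{\lambda_1,\ldots,\widehat{\lambda_i},\ldots,\lambda_{j-1},\lambda_i+\lambda_j,\ldots,\lambda_n}(x_1,\ldots,\widehat{x_i},\ldots,x_{j-1},[{x_i}_{\lambda_i}x_j],\ldots,x_{n+1}),$$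 where for $j=n+1$ the subscripts are just $\lambda_1,\ldots,\widehat{\lambda_i},\ldots,\lambda_n$. One has $\delta^2=0$; $Z^3(\mathfrak{g},M)=\ker(\delta|_{C^3})$ and $H^3(\mathfrak{g},M)=Z^3(\mathfrak{g},M)/\delta(C^2(\mathfrak{g},M))$. A $2$-term $Leib_\infty$-conformal algebra $(\mathcal{G}_1\xrightarrow{d}\mathcal{G}_0,\rho_2,\rho_3)$ consists of a complex of $\mathbb{C}[\partial]$-modules $\mathcal{G}_1\xrightarrow{d}\mathcal{G}_0$, conformal sesquilinear maps $\rho_2:\mathcal{G}_i\otimes\mathcal{G}_j\to\mathcal{G}_{i+j}[[\lambda]]$ for $0\le i,j,i+j\le1$, and a conformal sesquilinear map $\rho_3:\mathcal{G}_0^{\otimes3}\to\mathcal{G}_1[[\lambda,\mu]]$ such that for all $x,y,z,w\in\mathcal{G}_0$, $u,v\in\mathcal{G}_1$: (i) $(\rho_2)_\lambda(u,v)=0$ (i.e. $\rho_2$ is zero on $\mathcal{G}_1\otimes\mathcal{G}_1$); (ii) $d((\rho_2)_\lambda(x,u))=(\rho_2)_\lambda(x,du)$; (iii) $d((\rho_2)_\lambda(u,x))=(\rho_2)_\lambda(du,x)$; (iv) $(\rho_2)_\lambda(du,v)=(\rho_2)_\lambda(u,dv)$; (v) $d((\rho_3)_{\lambda,\mu}(x,y,z))=(\rho_2)_\lambda(x,(\rho_2)_\mu(y,z))-(\rho_2)_{\lambda+\mu}((\rho_2)_\lambda(x,y),z)-(\rho_2)_\mu(y,(\rho_2)_\lambda(x,z))$;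 (vi) $(\rho_3)_{\lambda,\mu}(x,y,dv)=(\rho_2)_\lambda(x,(\rho_2)_\mu(y,v))-(\rho_2)_{\lambda+\mu}((\rho_2)_\lambda(x,y),v)-(\rho_2)_\mu(y,(\rho_2)_\lambda(x,v))$; (vii) $(\rho_3)_{\lambda,\mu}(x,dv,y)=(\rho_2)_\lambda(x,(\rho_2)_\mu(v,y))-(\rho_2)_{\lambda+\mu}((\rho_2)_\lambda(x,v),y)-(\rho_2)_\mu(v,(\rho_2)_\lambda(x,y))$; (viii) $(\rho_3)_{\lambda,\mu}(dv,x,y)=(\rho_2)_\lambda(v,(\rho_2)_\mu(x,y))-(\rho_2)_{\lambda+\mu}((\rho_2)_\lambda(v,x),y)-(\rho_2)_\mu(x,(\rho_2)_\lambda(v,y))$; (ix) $(\rho_2)_\lambda(x,(\rho_3)_{\mu,\nu}(y,z,w))-(\rho_2)_\mu(y,(\rho_3)_{\lambda,\nu}(x,z,w))+(\rho_2)_\nu(z,(\rho_3)_{\lambda,\mu}(x,y,w))+(\rho_2)_{\lambda+\mu+\nu}((\rho_3)_{\lambda,\mu}(x,y,z),w)-(\rho_3)_{\lambda+\mu,\nu}((\rho_2)_\lambda(x,y),z,w)-(\rho_3)_{\mu,\lambda+\nu}(y,(\rho_2)_\lambda(x,z),w)-(\rho_3)_{\mu,\nu}(y,z,(\rho_2)_\lambda(x,w))+(\rho_3)_{\lambda,\mu+\nu}(x,(\rho_2)_\mu(y,z),w)+(\rho_3)_{\lambda,\nu}(x,z,(\rho_2)_\mu(y,w))-(\rho_3)_{\lambda,\mu}(x,y,(\rho_2)_\nu(z,w))=0$.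 It is skeletal if $d=0$. In that case $\mathcal{G}_0$ is a Leibniz conformal algebra with $\lambda$-bracket $[x_\lambda y]=(\rho_2)_\lambda(x,y)$, and $\mathcal{G}_1$ is a representation of it with $x_\lambda v=(\rho_2)_\lambda(x,v)$ and $v_\lambda x=(\rho_2)_\lambda(v,x)$. Two skeletal $Leib_\infty$-conformal algebras $(\mathcal{G}_1\xrightarrow{0}\mathcal{G}_0,\rho_2,\rho_3)$ and $(\mathcal{G}_1\xrightarrow{0}\mathcal{G}_0,\rho'_2,\rho'_3)$ on the same underlying complex are equivalent if $\rho_2=\rho'_2$ and there is a conformal sesquilinear map $\tau:\mathcal{G}_0\otimes\mathcal{G}_0\to\mathcal{G}_1[[\lambda]]$ with $\rho'_3=\rho_3+\delta\tau$, where $\delta$ is the coboundary map of the Leibniz conformal algebra $\mathcal{G}_0$ with coefficients in the representation $\mathcal{G}_1$. *)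

(* Defs.v *)
From HB Require Import structures.
From mathcomp Require Import all_boot all_order all_algebra.
From mathcomp Require Import boolp classical_sets functions reals.
From mathcomp Require Import complex mpoly.

Set Implicit Arguments.
Unset Strict Implicit.
Unset Printing Implicit Defensive.

Import GRing.Theory.
Local Open Scope ring_scope.

(* The complex numbers are R[i] for R : realType.  A C[d]-module is a left
   module over {poly R[i]}: 'X acts as the derivation d and c%:P as the complex
   scalar c.  For n : nat, M[[lambda_0, ..., lambda_(n-1)]] is the type of
   functions from the monomials 'X_{1..n} to M; through the pointwise module
   structure on functions, 'X *: F is d applied coefficientwise to F. *)
Notation dmodType R := (lmodType {poly R[i]}).
Notation fps n M := ('X_{1..n} -> M).

Section PowerSeries.
Variable R : realType.

(* Product of a polynomial in the lambda_i and a power series. *)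
Definition ps_mul n (N : dmodType R) (p : {mpoly R[i][n]}) (F : fps n N) :
    fps n N :=
  fun m => \sum_(k : 'X_{1..n < (mdeg m).+1} | (k <= m)%MM)
             (p@_k)%:P *: F (m - k)%MM.

(* F_(l_0, ..., l_(k-1)), the substitution of l_j for the j-th variable of F.
   It is only used with each l_j a sum of variables; for polynomials l_j without
   constant term the monomials of F of degree > mdeg m do not contribute to the
   coefficient at m, so that the sum below is the whole coefficient. *)
Definition ps_subst k n (N : dmodType R) (F : fps k N)
    (l : k.-tuple {mpoly R[i][n]}) : fps n N :=
  fun m => \sum_(a : 'X_{1..k < (mdeg m).+1})
             ((\prod_(j < k) tnth l j ^+ (a : 'X_{1..k}) j)@_m)%:P *: F a.

Definition at1 n (N : dmodType R) (F : fps 1 N) (p : {mpoly R[i][n]}) :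
    fps n N :=
  ps_subst F [tuple p].

Definition at2 n (N : dmodType R) (F : fps 2 N) (p q : {mpoly R[i][n]}) :
    fps n N :=
  ps_subst F [tuple p; q].

(* Coefficientwise extension of f : M -> N[[lambda]] to power series arguments:
   sum_k lambda^k u_k is sent to sum_k lambda^k f(u_k). *)
Definition ps_ext n (M N : dmodType R) (f : M -> fps n N) (F : fps n M) :
    fps n N :=
  fun m => \sum_(k : 'X_{1..n < (mdeg m).+1} | (k <= m)%MM)
             f (F k) (m - k)%MM.

(* x_p F and F_p y, for a binary operation f valued in power series in one
   variable. *)
Definition lapp n (A B N : dmodType R) (f : A -> B -> fps 1 N)
    (x : A) (p : {mpoly R[i][n]}) (F : fps n B) : fps n N :=
  ps_ext (fun u => at1 (f x u) p) F.

Definition rapp n (A B N : dmodType R) (f : A -> B -> fps 1 N)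
    (F : fps n A) (p : {mpoly R[i][n]}) (y : B) : fps n N :=
  ps_ext (fun u => at1 (f u y) p) F.

End PowerSeries.

(* lambda in one variable; lambda, mu in two; lambda, mu, nu in three. *)
Notation la1 := ('X_(@Ordinal 1 0 isT)).
Notation la2 := ('X_(@Ordinal 2 0 isT)).
Notation mu2 := ('X_(@Ordinal 2 1 isT)).
Notation la3 := ('X_(@Ordinal 3 0 isT)).
Notation mu3 := ('X_(@Ordinal 3 1 isT)).
Notation nu3 := ('X_(@Ordinal 3 2 isT)).

Section ConformalAlgebras.
Variable R : realType.

(* Linear maps on a tensor product are represented by multilinear maps. *)
Definition conformal_bilinear (A B N : dmodType R) (f : A -> B -> fps 1 N) :
    Prop :=
  [/\ forall (c : R[i]) x x' y, f (c%:P *: x + x') y = c%:P *: f x y + f x' y,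
      forall (c : R[i]) x y y', f x (c%:P *: y + y') = c%:P *: f x y + f x y',
      forall x y, f ('X *: x) y = - ps_mul la1 (f x y)
    & forall x y, f x ('X *: y) = 'X *: f x y + ps_mul la1 (f x y)].

Definition tupd n (T : Type) (x : n.-tuple T) (i : 'I_n) (a : T) : n.-tuple T :=
  [tuple if j == i then a else tnth x j | j < n].

Definition conformal_sesquilinear n (M N : dmodType R)
    (phi : n.+1.-tuple M -> fps n N) : Prop :=
  [/\ forall x (i : 'I_n.+1) (c : R[i]) u v,
        phi (tupd x i (c%:P *: u + v))
        = c%:P *: phi (tupd x i u) + phi (tupd x i v),
      forall x (i : 'I_n), let i' := widen_ord (leqnSn n) i in
        phi (tupd x i' ('X *: tnth x i')) = - ps_mul 'X_i (phi x)
    & forall x,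
        phi (tupd x ord_max ('X *: tnth x ord_max))
        = 'X *: phi x + ps_mul (\sum_(i < n) 'X_i) (phi x)].

Record leib_conf := LeibConf {
  lc_mod : dmodType R;
  lc_br : lc_mod -> lc_mod -> fps 1 lc_mod;
  _ : conformal_bilinear lc_br;
  _ : forall x y z,
        lapp lc_br x la2 (at1 (lc_br y z) mu2)
        = rapp lc_br (at1 (lc_br x y) la2) (la2 + mu2) z
          + lapp lc_br y mu2 (at1 (lc_br x z) la2) }.

Record representation (g : leib_conf) := Representation {
  rep_mod : dmodType R;
  rep_l : lc_mod g -> rep_mod -> fps 1 rep_mod;
  rep_r : rep_mod -> lc_mod g -> fps 1 rep_mod;
  _ : conformal_bilinear rep_l;
  _ : conformal_bilinear rep_r;
  _ : forall x y v,
        lapp rep_l x la2 (at1 (rep_l y v) mu2)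
        = rapp rep_l (at1 (lc_br x y) la2) (la2 + mu2) v
          + lapp rep_l y mu2 (at1 (rep_l x v) la2);
  _ : forall x v y,
        lapp rep_l x la2 (at1 (rep_r v y) mu2)
        = rapp rep_r (at1 (rep_l x v) la2) (la2 + mu2) y
          + lapp rep_r v mu2 (at1 (lc_br x y) la2);
  _ : forall v x y,
        lapp rep_r v la2 (at1 (lc_br x y) mu2)
        = rapp rep_r (at1 (rep_r v x) la2) (la2 + mu2) y
          + lapp rep_l x mu2 (at1 (rep_r v y) la2) }.

(* The coboundary C^(n+1) -> C^(n+2), which involves no axiom on the operations.
   Indices start at 0: the arguments are x_0, ..., x_(n+1), the variables are
   lambda_0, ..., lambda_n, and lift i enumerates the indices other than i. *)
Definition coboundary n (g M : dmodType R) (br : g -> g -> fps 1 g)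
    (l : g -> M -> fps 1 M) (r : M -> g -> fps 1 M)
    (phi : n.+1.-tuple g -> fps n M) (x : n.+2.-tuple g) : fps n.+1 M :=
  let wid (i : 'I_n.+1) : 'I_n.+2 := widen_ord (leqnSn n.+1) i in
    \sum_(i < n.+1) (-1) ^+ i *:
      lapp l (tnth x (wid i)) 'X_i
        (ps_subst (phi [tuple tnth x (lift (wid i) k) | k < n.+1])
                  [tuple 'X_(lift i k) | k < n])
  + (-1) ^+ n *:
      rapp r (ps_subst (phi [tuple tnth x (wid k) | k < n.+1])
                       [tuple 'X_(widen_ord (leqnSn n) k) | k < n])
        (\sum_(i < n.+1) 'X_i) (tnth x ord_max)
  + \sum_(i < n.+1) \sum_(j < n.+2 | (i < j)%N) (-1) ^+ i.+1 *:
      ps_ext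
        (fun a => ps_subst
           (phi [tuple if lift (wid i) k == j then a
                       else tnth x (lift (wid i) k) | k < n.+1])
           [tuple if lift i k == j :> nat then 'X_i + 'X_(lift i k)
                  else 'X_(lift i k) | k < n])
        (at1 (br (tnth x (wid i)) (tnth x j)) 'X_i).

Section Cohomology.
Variables (g : leib_conf) (M : representation g).

Definition delta n (phi : n.+1.-tuple (lc_mod g) -> fps n (rep_mod M)) :=
  coboundary (@lc_br g) (@rep_l g M) (@rep_r g M) phi.

Definition Z3 :=
  {theta : 3.-tuple (lc_mod g) -> fps 2 (rep_mod M)
     | conformal_sesquilinear theta /\ delta theta = 0}.

Definition cohomologous (theta theta' : Z3) : Prop :=
  exists tau : 2.-tuple (lc_mod g) -> fps 1 (rep_mod M),
    conformal_sesquilinear tau /\ sval theta' = sval theta + delta tau.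

(* H3 is the set of cosets of delta(C^2) in Z3. *)
Definition coset3 (theta : Z3) : Z3 -> Prop := cohomologous theta.

Definition H3 := {c : Z3 -> Prop | exists theta, c = coset3 theta}.

Definition class3 (theta : Z3) : H3 :=
  exist _ (coset3 theta) (ex_intro _ theta erefl).

End Cohomology.

(* The operation rho_2 is given by its components on G_0 (x) G_0, G_0 (x) G_1 and
   G_1 (x) G_0; its vanishing on G_1 (x) G_1 is encoded by the absence of a
   component there. *)
Record two_term := TwoTerm {
  tt_0 : dmodType R;
  tt_1 : dmodType R;
  tt_d : tt_1 -> tt_0;
  rho00 : tt_0 -> tt_0 -> fps 1 tt_0;
  rho01 : tt_0 -> tt_1 -> fps 1 tt_1;
  rho10 : tt_1 -> tt_0 -> fps 1 tt_1;
  rho3 : 3.-tuple tt_0 -> fps 2 tt_1 }.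

Record is_Leib_infty (G : two_term) : Prop := {
  li_d_linear : linear (@tt_d G);
  li_rho00 : conformal_bilinear (@rho00 G);
  li_rho01 : conformal_bilinear (@rho01 G);
  li_rho10 : conformal_bilinear (@rho10 G);
  li_rho3 : conformal_sesquilinear (@rho3 G);
  li_ii : forall (x : tt_0 G) (u : tt_1 G),
    @tt_d G \o rho01 x u = rho00 x (tt_d u);
  li_iii : forall (x : tt_0 G) (u : tt_1 G),
    @tt_d G \o rho10 u x = rho00 (tt_d u) x;
  li_iv : forall u v : tt_1 G, rho01 (tt_d u) v = rho10 u (tt_d v);
  li_v : forall x y z : tt_0 G,
    @tt_d G \o rho3 [tuple x; y; z]
    = lapp (@rho00 G) x la2 (at1 (rho00 y z) mu2)
      - rapp (@rho00 G) (at1 (rho00 x y) la2) (la2 + mu2) z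
      - lapp (@rho00 G) y mu2 (at1 (rho00 x z) la2);
  li_vi : forall (x y : tt_0 G) (v : tt_1 G),
    rho3 [tuple x; y; tt_d v]
    = lapp (@rho01 G) x la2 (at1 (rho01 y v) mu2)
      - rapp (@rho01 G) (at1 (rho00 x y) la2) (la2 + mu2) v
      - lapp (@rho01 G) y mu2 (at1 (rho01 x v) la2);
  li_vii : forall (x y : tt_0 G) (v : tt_1 G),
    rho3 [tuple x; tt_d v; y]
    = lapp (@rho01 G) x la2 (at1 (rho10 v y) mu2)
      - rapp (@rho10 G) (at1 (rho01 x v) la2) (la2 + mu2) y
      - lapp (@rho10 G) v mu2 (at1 (rho00 x y) la2);
  li_viii : forall (x y : tt_0 G) (v : tt_1 G),
    rho3 [tuple tt_d v; x; y]
    = lapp (@rho10 G) v la2 (at1 (rho00 x y) mu2)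
      - rapp (@rho10 G) (at1 (rho10 v x) la2) (la2 + mu2) y
      - lapp (@rho01 G) x mu2 (at1 (rho10 v y) la2);
  li_ix : forall x y z w : tt_0 G,
    lapp (@rho01 G) x la3 (at2 (rho3 [tuple y; z; w]) mu3 nu3)
    - lapp (@rho01 G) y mu3 (at2 (rho3 [tuple x; z; w]) la3 nu3)
    + lapp (@rho01 G) z nu3 (at2 (rho3 [tuple x; y; w]) la3 mu3)
    + rapp (@rho10 G) (at2 (rho3 [tuple x; y; z]) la3 mu3)
        (la3 + mu3 + nu3) w
    - ps_ext (fun a => at2 (rho3 [tuple a; z; w]) (la3 + mu3) nu3)
        (at1 (rho00 x y) la3)
    - ps_ext (fun a => at2 (rho3 [tuple y; a; w]) mu3 (la3 + nu3))
        (at1 (rho00 x z) la3)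
    - ps_ext (fun a => at2 (rho3 [tuple y; z; a]) mu3 nu3)
        (at1 (rho00 x w) la3)
    + ps_ext (fun a => at2 (rho3 [tuple x; a; w]) la3 (mu3 + nu3))
        (at1 (rho00 y z) mu3)
    + ps_ext (fun a => at2 (rho3 [tuple x; z; a]) la3 nu3)
        (at1 (rho00 y w) mu3)
    - ps_ext (fun a => at2 (rho3 [tuple x; y; a]) la3 mu3)
        (at1 (rho00 z w) nu3)
    = 0 }.

Definition skeletal (G : two_term) : Prop := forall u : tt_1 G, tt_d u = 0.

Definition skeletal_Leib_infty :=
  {G : two_term | is_Leib_infty G /\ skeletal G}.

(* The equality of two_term records says that S and S' have the same complex and
   the same rho_2, and that rho'_3 = rho_3 + delta tau. *)
Definition skel_equiv (S S' : skeletal_Leib_infty) : Prop :=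
  let: G := sval S in
  exists tau : 2.-tuple (tt_0 G) -> fps 1 (tt_1 G),
    conformal_sesquilinear tau /\
    sval S' =
      TwoTerm (@tt_d G) (@rho00 G) (@rho01 G) (@rho10 G)
        (@rho3 G + coboundary (@rho00 G) (@rho01 G) (@rho10 G) tau).

Definition skel_coset (S : skeletal_Leib_infty) : skeletal_Leib_infty -> Prop :=
  skel_equiv S.

Definition skeletal_classes :=
  {c : skeletal_Leib_infty -> Prop | exists S, c = skel_coset S}.

Definition skel_class (S : skeletal_Leib_infty) : skeletal_classes :=
  exist _ (skel_coset S) (ex_intro _ S erefl).

Record cocycle_triple := CocycleTriple {
  ct_alg : leib_conf;
  ct_rep : representation ct_alg;
  ct_cocycle : Z3 ct_rep }.

Record class_triple := ClassTriple {
  cl_alg : leib_conf;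
  cl_rep : representation cl_alg;
  cl_class : H3 cl_rep }.

Definition triple_class (t : cocycle_triple) : class_triple :=
  ClassTriple (class3 (ct_cocycle t)).

(* The structure maps M --0--> g, [. .], x_lambda v, v_lambda x, theta. *)
Definition triple_two_term (t : cocycle_triple) : two_term :=
  TwoTerm (fun=> 0) (@lc_br (ct_alg t)) (@rep_l _ (ct_rep t))
    (@rep_r _ (ct_rep t)) (sval (ct_cocycle t)).

End ConformalAlgebras.

(* Main.v *)
(* When d = 0, axioms (v)-(viii) lose their left-hand sides, because rho_3 is
   multilinear, and become the Jacobi identity of G_0 and the three axioms of
   the representation G_1; axiom (ix) is term by term delta rho_3 = 0.  So a
   skeletal algebra and a triple (g, M, theta) carry the same data, and differ
   only by proofs of propositions.  Equivalence of skeletal algebras fixes rho_2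
   and moves rho_3 by a coboundary, so that the equivalence class of a skeletal
   algebra is the image of the coset of its cocycle.  The identity delta^2 = 0
   is not needed: the second of two equivalent algebras satisfies (ix), hence
   rho_3 + delta tau is a cocycle. *)
Require Import Defs.
From mathcomp Require Import all_boot all_order all_algebra.
From mathcomp Require Import boolp classical_sets functions reals.
From mathcomp Require Import complex mpoly.

Set Implicit Arguments.
Unset Strict Implicit.
Unset Printing Implicit Defensive.

Import GRing.Theory.
Local Open Scope ring_scope.

Lemma sval_inj T (P : T -> Prop) : injective (@sval T P).
Proof. by move=> [x Px] [y Py] /= xy; apply: eq_exist. Qed.

Lemma subrfctE T (V : zmodType) (f g : T -> V) x : (f - g) x = f x - g x.
Proof. by []. Qed.

(** * Additivity of the power series operations *)

Section PowerSeries.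
Variable R : realType.

Lemma ps_mulB n (N : dmodType R) (p : {mpoly R[i][n]}) (F G : fps n N) :
  ps_mul p (F - G) = ps_mul p F - ps_mul p G.
Proof.
apply/funext => m; rewrite subrfctE /ps_mul -sumrB.
by apply: eq_bigr => k _; rewrite subrfctE scalerBr.
Qed.

Lemma ps_substB n k (N : dmodType R) (F G : fps k N)
    (s : k.-tuple {mpoly R[i][n]}) :
  ps_subst (F - G) s = ps_subst F s - ps_subst G s.
Proof.
apply/funext => m; rewrite subrfctE /ps_subst -sumrB.
by apply: eq_bigr => a _; rewrite subrfctE scalerBr.
Qed.

Lemma ps_extBr n (M N : dmodType R) (f : M -> fps n N) (F G : fps n M) :
  {morph f : u v / u - v} -> ps_ext f (F - G) = ps_ext f F - ps_ext f G.
Proof.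
move=> fB; apply/funext => m; rewrite subrfctE /ps_ext -sumrB.
by apply: eq_bigr => k _; rewrite subrfctE fB.
Qed.

Lemma ps_extBl n (M N : dmodType R) (f g : M -> fps n N) (F : fps n M) :
  ps_ext (f - g) F = ps_ext f F - ps_ext g F.
Proof.
by apply/funext => m; rewrite subrfctE /ps_ext -sumrB; apply: eq_bigr.
Qed.

End PowerSeries.

Section Conformal.
Variable R : realType.

(** * Operations and cochains: subtraction and vanishing at zero *)

Section Bilinear.
Variables (A B N : dmodType R) (f : A -> B -> fps 1 N).
Hypothesis fP : conformal_bilinear f.

Lemma conformal_bilinearBl y : {morph f^~ y : u v / u - v}.
Proof.
case: fP => fl _ _ _ u v /=.
(* Linearity with scalar [c = -1] is compatibility with subtraction. *)
by have := fl (-1) v u y; rewrite polyCN polyC1 !scaleN1r ![- _ + _]addrC.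
Qed.

Lemma conformal_bilinearBr x : {morph f x : u v / u - v}.
Proof.
case: fP => _ fr _ _ u v /=.
by have := fr (-1) x v u; rewrite polyCN polyC1 !scaleN1r ![- _ + _]addrC.
Qed.

Lemma conformal_bilinear0l y : f 0 y = 0.
Proof. by rewrite -(subrr 0) conformal_bilinearBl subrr. Qed.

Lemma conformal_bilinear0r x : f x 0 = 0.
Proof. by rewrite -(subrr 0) conformal_bilinearBr subrr. Qed.

Lemma lappB n x (p : {mpoly R[i][n]}) (F G : fps n B) :
  lapp f x p (F - G) = lapp f x p F - lapp f x p G.
Proof.
by apply: ps_extBr => u v; rewrite conformal_bilinearBr /at1 ps_substB.
Qed.

Lemma rappB n y (p : {mpoly R[i][n]}) (F G : fps n A) :
  rapp f (F - G) p y = rapp f F p y - rapp f G p y.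
Proof.
by apply: ps_extBr => u v; rewrite conformal_bilinearBl /at1 ps_substB.
Qed.

End Bilinear.

Section Sesquilinear.
Variables (n : nat) (M N : dmodType R).
Implicit Types phi psi : n.+1.-tuple M -> fps n N.

Lemma conformal_sesquilinearB phi psi :
  conformal_sesquilinear phi -> conformal_sesquilinear psi ->
  conformal_sesquilinear (phi - psi).
Proof.
case=> pl pd pm [ql qd qm]; split=> [x i c u v|x i|x].
- by rewrite !subrfctE pl ql scalerBr opprD addrACA.
- by rewrite /= !subrfctE pd qd ps_mulB opprB opprK addrC.
- by rewrite !subrfctE pm qm ps_mulB scalerBr opprD addrACA.
Qed.

Lemma tupd_tnth (x : n.+1.-tuple M) i : tupd x i (tnth x i) = x.
Proof. by apply: eq_from_tnth => j; rewrite tnth_mktuple; case: eqP => [->|]. Qed.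

(** Linearity in slot [i] at [1 *: 0 + 0] shows that the value added to itself is unchanged. *)
Lemma conformal_sesquilinear_eq0 phi x i :
  conformal_sesquilinear phi -> tnth x i = 0 -> phi x = 0.
Proof.
case=> pl _ _ xi0; rewrite -[x](tupd_tnth x i) xi0.
apply: (addrI (phi (tupd x i 0))).
by rewrite -[X in X + _ = _]scale1r -pl scaler0 !addr0.
Qed.

End Sesquilinear.

(** * The coboundary: additivity and its explicit form on 3-cochains *)

Section Coboundary.
Variables (g M : dmodType R) (br : g -> g -> fps 1 g).
Variables (l : g -> M -> fps 1 M) (r : M -> g -> fps 1 M).

(** In the action terms [phi] is an argument of [l] or [r], whose bilinearity passes the difference
    on; in the bracket terms it is the map being extended, and [ps_extBl] applies. *)
Lemma coboundaryB n (phi psi : n.+1.-tuple g -> fps n M) :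
  conformal_bilinear l -> conformal_bilinear r ->
  coboundary br l r (phi - psi)
  = coboundary br l r phi - coboundary br l r psi.
Proof.
move=> lP rP; apply/funext => x; rewrite subrfctE /coboundary.
rewrite 2!opprD addrACA [X in _ = X + _]addrACA -!sumrB; congr (_ + _ + _).
- by apply: eq_bigr => i _; rewrite !subrfctE ps_substB lappB // scalerBr.
- by rewrite ps_substB rappB // scalerBr.
apply: eq_bigr => i _; rewrite -sumrB; apply: eq_bigr => j _.
rewrite -scalerBr -ps_extBl; congr (_ *: ps_ext _ _).
by apply/funext => a; rewrite !subrfctE ps_substB.
Qed.

(** The right-hand side copies axiom (ix), which thereby becomes the cocycle condition. *)
Lemma coboundary3E (phi : 3.-tuple g -> fps 2 M) x y z w :
  coboundary br l r phi [tuple x; y; z; w]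
  = lapp l x la3 (at2 (phi [tuple y; z; w]) mu3 nu3)
    - lapp l y mu3 (at2 (phi [tuple x; z; w]) la3 nu3)
    + lapp l z nu3 (at2 (phi [tuple x; y; w]) la3 mu3)
    + rapp r (at2 (phi [tuple x; y; z]) la3 mu3) (la3 + mu3 + nu3) w
    - ps_ext (fun a => at2 (phi [tuple a; z; w]) (la3 + mu3) nu3)
        (at1 (br x y) la3)
    - ps_ext (fun a => at2 (phi [tuple y; a; w]) mu3 (la3 + nu3))
        (at1 (br x z) la3)
    - ps_ext (fun a => at2 (phi [tuple y; z; a]) mu3 nu3) (at1 (br x w) la3)
    + ps_ext (fun a => at2 (phi [tuple x; a; w]) la3 (mu3 + nu3))
        (at1 (br y z) mu3)
    + ps_ext (fun a => at2 (phi [tuple x; z; a]) la3 nu3) (at1 (br y w) mu3)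
    - ps_ext (fun a => at2 (phi [tuple x; y; a]) la3 mu3) (at1 (br z w) nu3).
Proof.
rewrite /coboundary.
(* The constraint [i < j] becomes an [if], so the sums unroll and the excluded pairs contribute
   0. *)
under [X in _ + X]eq_bigr => i _ do rewrite big_mkcond.
rewrite !big_ord_recr !big_ord0 /=.
rewrite !add0r ?addr0 expr0 expr1 sqrrN expr1n -signr_odd /= expr1.
rewrite !scale1r !scaleN1r !addrA.
have args3 (t t' : 3.-tuple g) :
    tnth t ord0 = tnth t' ord0 -> tnth t 1 = tnth t' 1 ->
    tnth t ord_max = tnth t' ord_max -> t = t'.
  move=> e0 e1 e2; apply: eq_from_tnth => -[[|[|[|k]]] klt] //.
  - by rewrite (_ : Ordinal klt = ord0) //; apply: val_inj.
  - by rewrite (_ : Ordinal klt = 1) //; apply: val_inj.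
  - by rewrite (_ : Ordinal klt = ord_max) //; apply: val_inj.
have vars2 (t : 2.-tuple {mpoly R[i][3]}) p q :
    tnth t ord0 = p -> tnth t ord_max = q -> t = [tuple p; q].
  move=> e0 e1; apply: eq_from_tnth => -[[|[|k]] klt] //.
  - by rewrite (_ : Ordinal klt = ord0) //; apply: val_inj.
  - by rewrite (_ : Ordinal klt = ord_max) //; apply: val_inj.
have X3 (j j' : 'I_3) : j = j' :> nat -> 'X_j = 'X_j' :> {mpoly R[i][3]}.
  by move/val_inj ->.
(* Goals 1-3 are left actions, 4 the right action, 5-10 the bracket terms; going from last to first
   keeps new subgoals from renumbering the others. *)
rewrite /at2; do 9?[congr (_ + _)]; try congr (- _).
5-10: congr (ps_ext _ (at1 _ _));
  try (apply/funext => a; congr (ps_subst (phi _) _)).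
4: congr (rapp _ (ps_subst (phi _) _) (_ + _ + _) _).
1-3: congr (lapp _ _ _ (ps_subst (phi _) _)).
all: try by apply: X3.
all: try by apply: args3; rewrite tnth_mktuple.
all: by apply: vars2; rewrite tnth_mktuple /=; do ?[congr (_ + _)]; apply: X3.
Qed.

End Coboundary.
End Conformal.

Section Correspondence.
Variable R : realType.

(** * From a skeletal algebra to a triple *)

Section SkeletalToTriple.
Variable G : two_term R.
Hypotheses (GP : is_Leib_infty G) (G0 : skeletal G).

Let d0 (n : nat) (F : fps n (tt_1 G)) : @tt_d R G \o F = 0.
Proof. by apply/funext => m; apply: G0. Qed.

(** Used on the left-hand sides of (vi), (vii), (viii), with [i] the last, middle and first slot. *)
Let rho3_d (x : 3.-tuple (tt_0 G)) (i : 'I_3) (u : tt_1 G) :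
  tnth x i = tt_d u -> rho3 x = 0.
Proof.
by rewrite G0; apply: conformal_sesquilinear_eq0; apply: li_rho3 GP.
Qed.

Lemma skeletal_jacobi x y z :
  lapp (@rho00 R G) x la2 (at1 (rho00 y z) mu2)
  = rapp (@rho00 R G) (at1 (rho00 x y) la2) (la2 + mu2) z
    + lapp (@rho00 R G) y mu2 (at1 (rho00 x z) la2).
Proof.
by apply/eqP; rewrite -subr_eq0 opprD addrA -(li_v GP) d0.
Qed.

Definition skeletal_alg : leib_conf R := LeibConf (li_rho00 GP) skeletal_jacobi.

Lemma skeletal_llm x y v :
  lapp (@rho01 R G) x la2 (at1 (rho01 y v) mu2)
  = rapp (@rho01 R G) (at1 (rho00 x y) la2) (la2 + mu2) v
    + lapp (@rho01 R G) y mu2 (at1 (rho01 x v) la2).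
Proof.
apply/eqP; rewrite -subr_eq0 opprD addrA -(li_vi GP).
by rewrite (@rho3_d _ ord_max v).
Qed.

Lemma skeletal_lml x v y :
  lapp (@rho01 R G) x la2 (at1 (rho10 v y) mu2)
  = rapp (@rho10 R G) (at1 (rho01 x v) la2) (la2 + mu2) y
    + lapp (@rho10 R G) v mu2 (at1 (rho00 x y) la2).
Proof.
apply/eqP; rewrite -subr_eq0 opprD addrA -(li_vii GP).
by rewrite (@rho3_d _ 1 v).
Qed.

Lemma skeletal_mll v x y :
  lapp (@rho10 R G) v la2 (at1 (rho00 x y) mu2)
  = rapp (@rho10 R G) (at1 (rho10 v x) la2) (la2 + mu2) y
    + lapp (@rho01 R G) x mu2 (at1 (rho10 v y) la2).
Proof.
apply/eqP; rewrite -subr_eq0 opprD addrA -(li_viii GP).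
by rewrite (@rho3_d _ ord0 v).
Qed.

Definition skeletal_rep : representation skeletal_alg :=
  @Representation R skeletal_alg _ _ _ (li_rho01 GP) (li_rho10 GP)
    skeletal_llm skeletal_lml skeletal_mll.

Lemma skeletal_cocycle :
  coboundary (@rho00 R G) (@rho01 R G) (@rho10 R G) (@rho3 R G) = 0.
Proof.
apply/funext => t; rewrite -[RHS]/0.
(* Both [coboundary3E] and (ix) concern explicit quadruples. *)
have -> : t = [tuple tnth t ord0; tnth t 1; tnth t 2%:R; tnth t ord_max].
  apply: eq_from_tnth => -[[|[|[|[|k]]]] klt] //=;
    by rewrite [RHS](tnth_nth 0) /=; congr (tnth t _); apply: val_inj.
by rewrite coboundary3E (li_ix GP).
Qed.

Definition skeletal_triple : cocycle_triple R :=
  @CocycleTriple R skeletal_alg skeletal_rep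
    (exist _ (@rho3 R G) (conj (li_rho3 GP) skeletal_cocycle)).

End SkeletalToTriple.

(** * The inverse construction and the first bijection *)

Definition triple_of (S : skeletal_Leib_infty R) : cocycle_triple R :=
  skeletal_triple (svalP S).1 (svalP S).2.

Lemma triple_ofK S : triple_two_term (triple_of S) = sval S.
Proof.
case: S => -[G0 G1 d r00 r01 r10 r3] [GP Gsk] /=.
(* Only the differentials differ in form; skeletality equates them. *)
by rewrite /triple_two_term /=; congr TwoTerm; apply/funext => u; rewrite [RHS]Gsk.
Qed.

(** With [d = 0], (ii)-(iv) hold because bilinear operations vanish at 0, and in (v)-(viii) both
    sides vanish. *)
Lemma triple_two_termP (t : cocycle_triple R) :
  is_Leib_infty (triple_two_term t) /\ skeletal (triple_two_term t).
Proof.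
split=> //.
case: t => -[g br brP jac] [M l r lP rP llm lml mll] [th [thP th0]].
rewrite /triple_two_term /=.
have th_eq0 (x : 3.-tuple g) i : tnth x i = 0 -> th x = 0.
  exact: conformal_sesquilinear_eq0.
split=> //=.
- by move=> c u v; rewrite scaler0 addr0.
- by move=> x u; rewrite (conformal_bilinear0r brP).
- by move=> x u; rewrite (conformal_bilinear0l brP).
- by move=> u v; rewrite (conformal_bilinear0l lP) (conformal_bilinear0r rP).
- by move=> x y z; rewrite jac -addrA -opprD subrr.
- by move=> x y v; rewrite (th_eq0 _ ord_max) // llm -addrA -opprD subrr.
- by move=> x y v; rewrite (th_eq0 _ 1) // lml -addrA -opprD subrr.
- by move=> x y v; rewrite (th_eq0 _ ord0) // mll -addrA -opprD subrr.
- by move=> x y z w; rewrite -coboundary3E [coboundary _ _ _ _]th0.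
Qed.

Definition skeletal_of (t : cocycle_triple R) : skeletal_Leib_infty R :=
  exist _ (triple_two_term t) (triple_two_termP t).

Lemma triple_ofKV : cancel triple_of skeletal_of.
Proof. by move=> S; apply: sval_inj; apply: triple_ofK. Qed.

Lemma skeletal_ofK : cancel skeletal_of triple_of.
Proof.
move=> t; rewrite /triple_of; move: (svalP (skeletal_of t)).
case: t => -[g br brP jac] [M l r lP rP llm lml mll] [th [thP th0]] /= [GP Gsk].
rewrite /skeletal_triple /skeletal_rep /skeletal_alg /=.
(* The equation cannot be split field by field: the type of the representation mentions the algebra
   record, that of the cocycle the representation. So the rebuilt proofs are generalized and
   identified by proof irrelevance. *)
move: (li_rho00 _) (skeletal_jacobi _ _) => /= brP' jac'.
move: (li_rho01 _) (li_rho10 _) => /= lP' rP'.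
move: (skeletal_llm _ _) (skeletal_lml _ _) (skeletal_mll _ _).
move=> /= llm' lml' mll'; move: (conj _ _) => thP'.
case: _ / (Prop_irrelevance brP brP'); case: _ / (Prop_irrelevance jac jac').
case: _ / (Prop_irrelevance lP lP'); case: _ / (Prop_irrelevance rP rP').
case: _ / (Prop_irrelevance llm llm'); case: _ / (Prop_irrelevance lml lml').
case: _ / (Prop_irrelevance mll mll').
by congr CocycleTriple; apply: eq_exist.
Qed.

(** * Cohomologous cocycles and their cosets *)

Section Cohomologous.
Variables (g : leib_conf R) (M : representation g).
Implicit Types theta : Z3 M.

Let lP : conformal_bilinear (@rep_l R g M). Proof. by case: M. Qed.
Let rP : conformal_bilinear (@rep_r R g M). Proof. by case: M. Qed.

Lemma deltaB n (phi psi : n.+1.-tuple (lc_mod g) -> fps n (rep_mod M)) :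
  delta (phi - psi) = delta phi - delta psi.
Proof. exact: coboundaryB. Qed.

Lemma delta0 n :
  delta (0 : n.+1.-tuple (lc_mod g) -> fps n (rep_mod M)) = 0.
Proof.
by have := deltaB (0 : n.+1.-tuple (lc_mod g) -> fps n (rep_mod M)) 0;
   rewrite !subrr.
Qed.

Lemma cohomologous_refl theta : cohomologous theta theta.
Proof.
exists (0 : 2.-tuple (lc_mod g) -> fps 1 (rep_mod M)); split; last first.
  by rewrite delta0 addr0.
have ps_mul0 (p : {mpoly R[i][1]}) : ps_mul p (0 : fps 1 (rep_mod M)) = 0.
  by have := ps_mulB p (0 : fps 1 (rep_mod M)) 0; rewrite !subrr.
by split=> *; rewrite /= ?ps_mul0 ?scaler0 ?oppr0 ?addr0.
Qed.

(** The two coboundaries differ by [delta (u - t)]. With reflexivity, this Euclidean form yields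
    symmetry and transitivity. *)
Lemma cohomologous_eucl theta1 theta2 theta3 :
  cohomologous theta1 theta2 -> cohomologous theta1 theta3 ->
  cohomologous theta2 theta3.
Proof.
move=> [t [tP e2]] [u [uP e3]]; exists (u - t); split.
  exact: conformal_sesquilinearB.
by rewrite e2 e3 deltaB -addrA [delta t + _]addrC subrK.
Qed.

Lemma eq_class3 theta theta' :
  cohomologous theta theta' -> class3 theta = class3 theta'.
Proof.
move=> tt'; apply: sval_inj; apply/predeqP => eta; split.
  exact: cohomologous_eucl.
(* The inner use reverses [tt']. *)
apply: cohomologous_eucl; apply: cohomologous_eucl (tt') _.
exact: cohomologous_refl.
Qed.

End Cohomologous.

(** * Equivalence of algebras against cohomology of cocycles *)

Lemma skel_equivP g (M : representation g) (theta : Z3 M) S :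
  skel_equiv (skeletal_of (CocycleTriple theta)) S <->
  exists2 theta', cohomologous theta theta' &
    S = skeletal_of (CocycleTriple theta').
Proof.
split=> [[tau [tauP SE]] | [theta' [tau [tauP tau_theta]] ->]]; last first.
  by exists tau; split=> //=; rewrite /triple_two_term /= tau_theta.
(* Along [SE], the axioms of [S] become statements about [theta + delta tau]. *)
have [SP _] := svalP S; rewrite SE in SP.
have theta'P : conformal_sesquilinear (sval theta + delta tau) /\
    delta (sval theta + delta tau) = 0.
  exact: conj (li_rho3 SP) (skeletal_cocycle SP).
exists (exist _ (sval theta + delta tau) theta'P : Z3 M).
  by exists tau.
exact: sval_inj.
Qed.

Lemma skel_equiv_refl (S : skeletal_Leib_infty R) : skel_equiv S S.
Proof.
rewrite -(triple_ofKV S); case: (triple_of S) => g M theta.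
by apply/skel_equivP; exists theta => //; apply: cohomologous_refl.
Qed.

(** [skel_equivP] puts both triples over the same [g] and [M], so that their classes can be compared
    in one [H3]. *)
Lemma eq_triple_class (S S' : skeletal_Leib_infty R) :
  skel_equiv S S' -> triple_class (triple_of S) = triple_class (triple_of S').
Proof.
rewrite -(triple_ofKV S); case: (triple_of S) => g M theta.
case/skel_equivP => theta' tt' ->.
by rewrite !skeletal_ofK /triple_class /= (eq_class3 tt').
Qed.

(** * The bijection on classes *)

Lemma triple_class_surj (c : class_triple R) : exists t, c = triple_class t.
Proof.
case: c => g M [c [theta e]]; exists (CocycleTriple theta).
by congr ClassTriple; apply: sval_inj.
Qed.

(** A representative is picked by choice; [triple_class_ofE] shows that the value is independent of
    it. *)
Definition triple_class_of (c : skeletal_classes R) : class_triple R :=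
  triple_class (triple_of (sval (cid (svalP c)))).

Lemma triple_class_ofE S :
  triple_class_of (skel_class S) = triple_class (triple_of S).
Proof.
rewrite /triple_class_of; case: cid => S' /= e.
(* [S'] lies in its own coset, which by [e] is that of [S]. *)
apply/esym/eq_triple_class; rewrite -/(skel_coset S _) e.
exact: skel_equiv_refl.
Qed.

(** The image of a whole coset under [skeletal_of], hence free of any choice of cocycle. *)
Definition skeletal_class_pred (c : class_triple R) :
    skeletal_Leib_infty R -> Prop :=
  fun S => exists2 theta, sval (cl_class c) theta &
    S = skeletal_of (CocycleTriple theta).

Lemma skeletal_class_predE t :
  skeletal_class_pred (triple_class t) = skel_coset (skeletal_of t).
Proof.
by apply/predeqP => S; case: t => g M theta; apply: iff_sym; apply: skel_equivP.
Qed.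

Lemma skeletal_class_pred_coset c :
  exists S, skeletal_class_pred c = skel_coset S.
Proof.
have [t ->] := triple_class_surj c.
by exists (skeletal_of t); apply: skeletal_class_predE.
Qed.

Definition skeletal_class_of (c : class_triple R) : skeletal_classes R :=
  exist _ (skeletal_class_pred c) (skeletal_class_pred_coset c).

Lemma skeletal_class_ofE t :
  skeletal_class_of (triple_class t) = skel_class (skeletal_of t).
Proof. by apply: sval_inj; apply: skeletal_class_predE. Qed.

Lemma triple_class_ofK : cancel triple_class_of skeletal_class_of.
Proof.
move=> [c [S e]].
(* Once the class is written through [S], both maps can be computed on representatives. *)
have -> : exist _ c (ex_intro _ S e) = skel_class S by apply: sval_inj.
by rewrite triple_class_ofE skeletal_class_ofE triple_ofKV.
Qed.

Lemma skeletal_class_ofK : cancel skeletal_class_of triple_class_of.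
Proof.
move=> c; have [t ->] := triple_class_surj c.
by rewrite skeletal_class_ofE triple_class_ofE skeletal_ofK.
Qed.

End Correspondence.

(* The first clause says that S = (G_1 --0--> G_0, rho_2, rho_3) is sent to
   (G_0, G_1, rho_3), with bracket and actions the components of rho_2. *)
Theorem theorem4p4 (R : realType) :
  exists F : skeletal_Leib_infty R -> cocycle_triple R,
    (forall S, triple_two_term (F S) = sval S) /\
    bijective F /\
    exists Fbar : skeletal_classes R -> class_triple R,
      (forall S, Fbar (skel_class S) = triple_class (F S)) /\
      bijective Fbar.
Proof.
exists (@triple_of R); split; first exact: triple_ofK.
split; first exact: Bijective (@triple_ofKV R) (@skeletal_ofK R).
exists (@triple_class_of R); split; first exact: triple_class_ofE.
exact: Bijective (@triple_class_ofK R) (@skeletal_class_ofK R).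
Qed.
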